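(* Let $\mathbb F_q$ be a finite field with $q$ elements, let $n\ge 0$ and let $d\ge e\ge 0$ be integers. Let $\mathcal B$ be a set of nonzero normalized homogeneous polynomials of degree $e$ in $\mathbb F_q[X_0,\dots,X_n]$ (i.e. nonzero classes in $\mathbb F_q[X_0,\dots,X_n]_e/\!\sim$) such that for any $G_1,G_2\in\mathcal B$ with $G_1\neq G_2$, the only common divisors of $G_1$ and $G_2$ in $\mathbb F_q[X_0,\dots,X_n]$ are the constants. Let $$\mathcal C_{\mathcal B}=\{V_G \mid G\in\mathcal B\},\qquad V_G=G\cdot \mathbb F_q[X_0,\dots,X_n]_{d-e}\subseteq \mathbb F_q[X_0,\dots,X_n]_d .$$ Then: (1) The ambient vector space $\mathbb F_q[X_0,\dots,X_n]_d$ has dimension $N=\binom{n+d}{n}$ over $\mathbb F_q$, and every $V\in\mathcal C_{\mathcal B}$ is an $\mathbb F_q$-linear subspace of dimension $l=\binom{n+d-e}{n}$. (2) The number of vector spaces in $\mathcal C_{\mathcal B}$ is $|\mathcal C_{\mathcal B}|=|\mathcal B|$. (3) The elements of $\mathcal C_{\mathcal B}$ are equidistant. More precisely, let $V_1,V_2\in\mathcal C_{\mathcal B}$ with $V_1\neq V_2$. - If $d-e<e$, then $\dim_{\mathbb F_q}(V_1\cap V_2)=0$ and $\mathrm{dist}(V_1,V_2)=2\binom{n+d-e}{n}$. - If $d-e\geq e$, then $\dim_{\mathbb F_q}(V_1\cap V_2)=\binom{n+d-2e}{n}$ and $$\mathrm{dist}(V_1,V_2)=2\left(\binom{n+d-e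}{n}-\binom{n+d-2e}{n}\right).$$
   Context: $\mathbb F_q[X_0,\dots,X_n]_m$ denotes the $\mathbb F_q$-vector space of homogeneous polynomials of degree $m$ in $X_0,\dots,X_n$ with coefficients in $\mathbb F_q$ (together with $0$). Normalized homogeneous polynomials of degree $e$ are the classes in $\mathbb F_q[X_0,\dots,X_n]_e/\!\sim$, where $F_1\sim F_2$ if and only if $F_1=cF_2$ for some $c\in\mathbb F_q^*$. Divisibility properties and the subspace $V_G=G\cdot\mathbb F_q[X_0,\dots,X_n]_{d-e}=\{GF : F\in \mathbb F_q[X_0,\dots,X_n]_{d-e}\}$ depend only on the class of $G$. ''Constants'' means polynomials of degree $0$. For finite-dimensional $\mathbb F_q$-linear subspaces $V_1,V_2$ of a common vector space, the distance is $\mathrm{dist}(V_1,V_2):=\dim_{\mathbb F_q}(V_1+V_2)-\dim_{\mathbb F_q}(V_1\cap V_2)$. *)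

(* Defs.v *)
From HB Require Import structures.
From mathcomp Require Import all_boot all_algebra.
From mathcomp Require Import generic_quotient.
From mathcomp.multinomials Require Export mpoly.

Set Implicit Arguments.
Unset Strict Implicit.
Unset Printing Implicit Defensive.

Import GRing.Theory.
Local Open Scope ring_scope.
Local Open Scope quotient_scope.

Section FiniteVspace.
Variables (F : finFieldType) (vT : vectType F).

HB.instance Definition _ := Choice_isCountable.Build {vspace vT}
  (pcan_pickleK (can_pcan (@VectorInternalTheory.vs2mxK F vT))).
HB.instance Definition _ : isFinite {vspace vT} :=
  CanIsFinite (@VectorInternalTheory.vs2mxK F vT).

End FiniteVspace.

(* No truncation occurs: [V1 :&: V2] is contained in [V1 + V2]. *)
Definition distv (K : fieldType) (vT : vectType K) (V1 V2 : {vspace vT}) : nat :=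
  (\dim (V1 + V2) - \dim (V1 :&: V2))%N.

Definition mdvd (n : nat) (R : comNzRingType) (D P : {mpoly R[n]}) : Prop :=
  exists Q : {mpoly R[n]}, P = D * Q.

(* [dhomog n.+1 F m] is the vector space of homogeneous polynomials of degree m
   in the n.+1 variables X_0, ..., X_n, zero polynomial included. *)
Section FiniteDhomog.
Variables (F : finFieldType) (n m : nat).

HB.instance Definition _ := Choice_isCountable.Build (dhomog n.+1 F m)
  (pcan_pickleK (can_pcan (@VectorInternalTheory.v2rK F (dhomog n.+1 F m)))).
HB.instance Definition _ : isFinite (dhomog n.+1 F m) :=
  CanIsFinite (@VectorInternalTheory.v2rK F (dhomog n.+1 F m)).

End FiniteDhomog.

Section NormalizedForms.
Variables (F : finFieldType) (n e : nat).
Implicit Types G H : dhomog n.+1 F e.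

Definition proportional G H : bool :=
  [exists c : F, (c != 0) && (G == c *: H)].

Lemma proportional_refl : reflexive proportional.
Proof.
by move=> G; apply/existsP; exists 1; rewrite oner_neq0 scale1r eqxx.
Qed.

Lemma proportional_sym : ssrbool.symmetric proportional.
Proof.
have sub G H : proportional G H -> proportional H G.
  case/existsP=> c /andP[c0 /eqP ->]; apply/existsP; exists c^-1.
  by rewrite invr_neq0 // scalerA mulVf // scale1r eqxx.
by move=> G H; apply/idP/idP; apply: sub.
Qed.

Lemma proportional_trans : transitive proportional.
Proof.
move=> H G K /existsP[a /andP[a0 /eqP ->]] /existsP[b /andP[b0 /eqP ->]].
by apply/existsP; exists (a * b); rewrite mulf_neq0 // scalerA eqxx.
Qed.

Canonical proportional_equiv :=
  EquivRel proportional proportional_refl proportional_sym proportional_trans.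

Definition nform := {eq_quot proportional_equiv}.

HB.instance Definition _ := EqQuotient.on nform.
HB.instance Definition _ := Choice.on nform.
HB.instance Definition _ :=
  Choice_isCountable.Build nform (pcan_pickleK (can_pcan (@reprK _ nform))).
HB.instance Definition _ : isFinite nform := CanIsFinite (@reprK _ nform).

Definition nform0 : nform := \pi_nform (0 : dhomog n.+1 F e).

Lemma nform0E G : (\pi_nform G == nform0) = (G == 0).
Proof.
rewrite eqmodE; apply/existsP/eqP => [[c /andP[_ /eqP->]]|->].
  by rewrite scaler0.
by exists 1; rewrite oner_neq0 scaler0 eqxx.
Qed.

End NormalizedForms.

(* The degree of G is kept separate from d, so a product with a form of degree
   d - e has degree e + (d - e); [indhomog d] reads it in degree d. It is the
   product itself when e <= d (mulformE). *)
Definition mulform (F : finFieldType) (n d e : nat) (G : dhomog n.+1 F e)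
    (P : dhomog n.+1 F (d - e)) : dhomog n.+1 F d :=
  indhomog d (mpoly_of_dhomog G * mpoly_of_dhomog P).

Definition formspan (F : finFieldType) (n d e : nat) (G : dhomog n.+1 F e) :
    {vspace dhomog n.+1 F d} :=
  limg (linfun (mulform (d := d) G)).

Section FormSpan.
Variables (F : finFieldType) (n d e : nat).
Hypothesis led : (e <= d)%N.
Implicit Types G : dhomog n.+1 F e.

Lemma mulformE G (P : dhomog n.+1 F (d - e)) :
  mpoly_of_dhomog (mulform G P) = mpoly_of_dhomog G * mpoly_of_dhomog P.
Proof.
rewrite -[LHS]/(val (insubd _ _)) insubdK //.
by have := dhomogM (dhomog_is_dhomog G) (dhomog_is_dhomog P); rewrite subnKC.
Qed.

Lemma mulform_is_linear G : linear (mulform (d := d) G).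
Proof.
move=> c P Q; apply/val_inj.
rewrite -!/(mpoly_of_dhomog _) linearP /= !mulformE linearP /=.
by rewrite mulrDr scalerAr.
Qed.

Lemma formspanP G (H : dhomog n.+1 F d) :
  reflect (exists P : dhomog n.+1 F (d - e),
             mpoly_of_dhomog H = mpoly_of_dhomog G * mpoly_of_dhomog P)
          (H \in formspan d G).
Proof.
pose f := GRing.isLinear.Build _ _ _ _ _ (mulform_is_linear G).
pose g : {linear _ -> _} := HB.pack (mulform (d := d) G) f.
have fE : linfun (mulform (d := d) G) =1 mulform G := lfunE g.
apply: (iffP memv_imgP) => [[P _ ->]|[P HE]].
  by exists P; rewrite fE mulformE.
by exists P; rewrite ?memvf // fE; apply/val_inj; rewrite /= mulformE.
Qed.

Lemma formspan_proportional G1 G2 :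
  proportional G1 G2 -> formspan d G1 = formspan d G2.
Proof.
have sub G H : proportional G H -> (formspan d G <= formspan d H)%VS.
  case/existsP=> c /andP[_ /eqP GE]; apply/subvP => K /formspanP[P KE].
  by apply/formspanP; exists (c *: P); rewrite KE GE !linearZ /= -scalerAl -scalerAr.
move=> G12; apply/eqP; rewrite eqEsubv !sub //.
by rewrite proportional_sym.
Qed.

End FormSpan.

Section Code.
Variables (F : finFieldType) (n d e : nat).

(* By formspan_proportional the choice of representative is irrelevant. *)
Definition nformspan (G : nform F n e) : {vspace dhomog n.+1 F d} :=
  formspan d (repr G).

Lemma nformspanE (G : dhomog n.+1 F e) :
  (e <= d)%N -> nformspan (\pi_(nform F n e) G) = formspan d G.
Proof.
by move=> led; apply: formspan_proportional => //; apply/eqmodP; rewrite reprK.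
Qed.

Definition nformcode (B : {set nform F n e}) : {set {vspace dhomog n.+1 F d}} :=
  [set nformspan G | G in B].

End Code.

Definition nfdvd (F : finFieldType) (n e : nat) (D : {mpoly F[n.+1]})
    (G : nform F n e) : Prop :=
  mdvd D (mpoly_of_dhomog (repr G)).

Lemma nfdvdE (F : finFieldType) (n e : nat) (D : {mpoly F[n.+1]})
    (G : dhomog n.+1 F e) :
  nfdvd D (\pi_(nform F n e) G) <-> mdvd D (mpoly_of_dhomog G).
Proof.
have sub (H K : dhomog n.+1 F e) : proportional H K ->
    mdvd D (mpoly_of_dhomog K) -> mdvd D (mpoly_of_dhomog H).
  case/existsP=> c /andP[_ /eqP ->] [Q KE]; exists (c *: Q).
  by rewrite linearZ /= KE scalerAr.
have GE : proportional (repr (\pi_(nform F n e) G)) G.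
  by apply/eqmodP; rewrite reprK.
by split; apply: sub => //; rewrite proportional_sym.
Qed.

(* Main.v *)
(* By Gauss's lemma and induction on the number of variables, every nonzero
   polynomial over a field is a unit times a product of primes. Hence, for
   coprime G1 and G2, an element G1 P = G2 Q of the intersection of V_G1 and
   V_G2 has P divisible by G2, so that the intersection is V_(G1 G2), or 0 when
   2e > d. As for the injectivity of G |-> V_G: if V_G1 = V_G2 with G1 and G2
   coprime, comparing dimensions forces n = 0 or e = 0, and then the forms of
   degree e make up a line, so that G1 and G2 are proportional. *)
Require Import Defs.
From HB Require Import structures.
From mathcomp Require Import all_boot all_algebra generic_quotient zify.
From Stdlib Require Import Classical.

Set Implicit Arguments.
Unset Strict Implicit.
Unset Printing Implicit Defensive.

Import GRing.Theory.
Local Open Scope ring_scope.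
Local Open Scope quotient_scope.

(** * Products of primes in an integral domain *)

Definition divides (R : comNzRingType) (a b : R) : Prop := exists c, b = a * c.

Definition prime_elt (R : idomainType) (p : R) : Prop :=
  [/\ p != 0, p \isn't a GRing.unit
    & forall a b, divides p (a * b) -> divides p a \/ divides p b].

Inductive prime_product (R : idomainType) : R -> Prop :=
| PrimeProductUnit u of u \is a GRing.unit : prime_product u
| PrimeProductMul p a of prime_elt p & prime_product a : prime_product (p * a).

(** The factors are prime rather than merely irreducible, so existence alone is required: uniqueness
    follows from it. *)
Definition ufd (R : idomainType) : Prop :=
  forall a : R, a != 0 -> prime_product a.

Section PrimeProducts.
Variable R : idomainType.
Implicit Types a b c p : R.

Lemma prime_not_dvd_unit p u :
  prime_elt p -> u \is a GRing.unit -> ~ divides p u.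
Proof.
move=> [_ /negP np _] uu [x ux]; apply: np.
by move: uu; rewrite ux unitrM => /andP[].
Qed.

Lemma prime_productM a b :
  prime_product a -> prime_product b -> prime_product (a * b).
Proof.
move=> Pa Pb; elim: Pa => [u uu|p c Pp _ IHc]; last first.
  by rewrite -mulrA; apply: PrimeProductMul.
elim: Pb => [v vu|p c Pp _ IHc].
  by apply: PrimeProductUnit; rewrite unitrM uu.
by rewrite mulrCA; apply: PrimeProductMul.
Qed.

(** The primes of [a] are cancelled one at a time: each divides [b * c] but not [b], hence divides
    [c]. *)
Lemma coprime_dvdM a b c : prime_product a ->
    (forall p, prime_elt p -> divides p a -> ~ divides p b) ->
  divides a (b * c) -> divides a c.
Proof.
move=> Pa; elim: Pa c => [u uu|p {}a Pp Pa IHa] c cop.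
  by move=> _; exists (u^-1 * c); rewrite mulVKr.
move=> [x bcE]; have [p0 _ pP] := Pp.
have [|[y bE]|[c' cE]] := pP b c; first by exists (a * x); rewrite mulrA.
  by case: (cop p Pp); [exists a | exists y].
have [||y c'E] := IHa c'; last by exists y; rewrite cE c'E mulrA.
- by move=> q Pq [z aE]; apply: cop => //; exists (p * z); rewrite aE mulrCA.
- by exists x; apply: (mulfI p0); rewrite [RHS]mulrA -bcE cE mulrCA.
Qed.

End PrimeProducts.

(** * Gauss's lemma: factorization in R[X] *)

Section PolyUfd.
Variable R : idomainType.
Implicit Types (p c : R) (f g : {poly R}).

(** Testing prime constants avoids speaking of a content, that is, of a gcd of the coefficients. *)
Definition primitive f : Prop :=
  forall p, prime_elt p -> ~ divides p%:P f.

Lemma polyC_unit c : (c%:P \is a GRing.unit) = (c \is a GRing.unit).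
Proof.
rewrite poly_unitE coefC size_polyC.
by have [->|_] := eqVneq c 0; rewrite ?unitr0.
Qed.

Lemma divides_lead_coef p f : divides p%:P f -> divides p (lead_coef f).
Proof.
by move=> [g ->]; exists (lead_coef g); rewrite lead_coefM lead_coefC.
Qed.

Lemma prime_polyC p : prime_elt p -> prime_elt p%:P.
Proof.
move=> Pp; have [p0 pu pP] := Pp.
split; rewrite ?polyC_eq0 ?polyC_unit // => f g.
(* The induction is on the sum of the sizes, since either factor may be the one to lose its leading
   term. *)
have [m] := ubnP (size f + size g); elim: m f g => // m IHm f g szm dfg.
have [->|f0] := eqVneq f 0; first by left; exists 0; rewrite mulr0.
have [->|g0] := eqVneq g 0; first by right; exists 0; rewrite mulr0.
(* p divides the leading coefficient of f or g, and dropping that leading term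
   does not affect divisibility by p. *)
have shrink h : h != 0 -> divides p (lead_coef h) ->
    exists k t, h = k + p%:P * t /\ (size k < size h)%N.
  move=> h0 [x hx]; pose q := 'X^((size h).-1) : {poly R}.
  exists (h - lead_coef h *: q), (x *: q); rewrite hx mul_polyC scalerA subrK.
  split=> //; rewrite -[X in (_ < X)%N]prednK ?size_poly_gt0 // ltnS.
  apply/leq_sizeP => j; rewrite leq_eqVlt coefB coefZ coefXn -hx.
  case/predU1P=> [<-|hj].
    by rewrite eqxx mulr1 subrr.
  rewrite gtn_eqF // mulr0 subr0 nth_default //.
  by rewrite -(prednK (n := size h)) ?size_poly_gt0.
have : divides p (lead_coef f * lead_coef g).
  by rewrite -lead_coefM; apply: divides_lead_coef.
move/pP=> [].
  move=> /(shrink _ f0)[k [t [fE ltk]]]; case: (IHm k g) => [||kd|gd].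
  - by rewrite -ltnS (leq_trans _ szm) // ltnS ltn_add2r.
  - have [x] := dfg; rewrite fE mulrDl => hx; exists (x - t * g).
    by rewrite mulrBr -hx mulrA addrK.
  - by left; rewrite fE; case: kd => x ->; exists (x + t); rewrite mulrDr.
  - by right.
move=> /(shrink _ g0)[k [t [gE ltk]]]; case: (IHm f k) => [||fd|kd].
- by rewrite -ltnS (leq_trans _ szm) // ltnS ltn_add2l.
- have [x] := dfg; rewrite gE mulrDr => hx; exists (x - f * t).
  by rewrite mulrBr -hx mulrCA addrK.
- by left.
- by right; rewrite gE; case: kd => x ->; exists (x + t); rewrite mulrDr.
Qed.

Lemma prime_product_polyC c : prime_product c -> prime_product c%:P.
Proof.
elim=> [u uu|p a Pp _ IHa].
  by apply: PrimeProductUnit; rewrite polyC_unit.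
by rewrite polyCM; apply: PrimeProductMul => //; apply: prime_polyC.
Qed.

Hypothesis factR : ufd R.

Lemma primitive_part f : f != 0 ->
  exists c g, [/\ c != 0, f = c%:P * g & primitive g].
Proof.
move=> f0; have: forall c, divides c%:P f -> divides c (lead_coef f).
  by move=> c; apply: divides_lead_coef.
have: prime_product (lead_coef f) by apply: factR; rewrite lead_coef_eq0.
(* a is a common multiple of the constants dividing f; each prime of a either
   divides f and is cancelled from both, or is superfluous in a. *)
move: (lead_coef f) => a Pa; elim: Pa f f0 => [u uu|p {}a Pp Pa IHa] f f0 fa.
  exists 1, f; rewrite oner_neq0 mul1r; split=> // p Pp /fa.
  exact: prime_not_dvd_unit.
have [p0 _ pP] := Pp.
have [[f' fE]|npf] := classic (divides p%:P f).
  have f'0 : f' != 0 by apply: contraNneq f0 => f'0; rewrite fE f'0 mulr0.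
  have [c [x xE]|c [g [c0 f'E prg]]] := IHa f' f'0.
    have [|y aE] := fa (p * c); first by exists x; rewrite fE xE polyCM mulrA.
    by exists y; apply: (mulfI p0); rewrite aE mulrA.
  by exists (p * c), g; split; rewrite ?mulf_neq0 // fE f'E polyCM mulrA.
apply: IHa => // c cf; have [x paE] := fa c cf; have := pP c x.
case; first by exists a; rewrite paE.
  move=> [y cE]; case: npf; case: cf => z ->; exists (y%:P * z).
  by rewrite cE polyCM mulrA.
by move=> [y xE]; exists y; apply: (mulfI p0); rewrite paE xE mulrCA.
Qed.

(** [dvdp] is divisibility up to a nonzero scalar, as over the fraction field: [c *: f = q * g].
    Each prime of [c] stays prime in R[X] and does not divide [g], so it divides [q] and cancels. *)
Lemma primitive_dvdp f g : primitive g -> Pdiv.Idomain.dvdp g f -> divides g f.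
Proof.
move=> prg /Pdiv.Idomain.dvdpP[[c q] /= c0].
elim: (factR c0) q => [u uu|p {c0}c Pp _ IHc] q fE.
  by exists (u^-1 *: q); rewrite mulrC -scalerAl -fE scalerA mulVr ?scale1r.
have [p0 _ pP] := Pp; have [_ _ PP] := prime_polyC Pp.
case: (PP q g); first by exists (c *: f); rewrite -fE mul_polyC scalerA.
  move=> [q' qE]; apply: (IHc q').
  apply: (@mulfI _ p%:P); first by rewrite polyC_eq0.
  by rewrite mul_polyC scalerA fE qE mulrA.
by move/(prg p Pp).
Qed.

(** [irreducible_poly] is irreducibility over the fraction field, where [g] is either coprime to [a]
    or divides it. Primitivity brings the resulting divisibility back to R[X]. *)
Lemma primitive_irreducible_prime g :
  primitive g -> irreducible_poly g -> prime_elt g.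
Proof.
move=> prg irrg; split=> [||a b [x abE]]; first exact: irredp_neq0.
  by rewrite poly_unitE; case: irrg; case: (size g) => [|[|k]].
have gab : Pdiv.Idomain.dvdp g (a * b).
  by rewrite abE Pdiv.Idomain.dvdp_mulr.
have [cop|ncop] := boolP (Pdiv.Idomain.coprimep g a).
  right; apply: primitive_dvdp => //.
  by rewrite -(Pdiv.Idomain.Gauss_dvdpr _ cop).
left; apply: primitive_dvdp => //.
have /Pdiv.Idomain.eqp_dvdl <- := irrg.2 _ ncop (Pdiv.Idomain.dvdp_gcdl g a).
exact: Pdiv.Idomain.dvdp_gcdr.
Qed.

Lemma irreducible_factor f : (1 < size f)%N ->
  exists2 g, irreducible_poly g & Pdiv.Idomain.dvdp g f.
Proof.
have [m] := ubnP (size f); elim: m f => // m IHm f szm szf.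
have f0 : f != 0 by rewrite -size_poly_gt0 ltnW.
have [irrf|nirr] := classic (forall q : {poly R}, size q != 1%N ->
  Pdiv.Idomain.dvdp q f -> Pdiv.Idomain.eqp q f).
  by exists f; rewrite ?Pdiv.Idomain.dvdpp.
have [q nq] := not_all_ex_not _ _ nirr.
have [szq nqf] := imply_to_and _ _ nq.
have [qf /negP neq] := imply_to_and _ _ nqf.
have q0 : q != 0 := Pdiv.Idomain.dvdpN0 qf f0.
have ltq : (size q < size f)%N.
  by rewrite ltn_neqAle Pdiv.Idomain.dvdp_size_eqp // neq Pdiv.Idomain.dvdp_leq.
have [||g irrg gq] := IHm q; last first.
- by exists g; rewrite ?(Pdiv.Idomain.dvdp_trans gq).
- by rewrite ltn_neqAle eq_sym szq size_poly_gt0.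
- by rewrite (leq_trans ltq).
Qed.

Lemma ufd_poly : ufd {poly R}.
Proof.
move=> f; have [m] := ubnP (size f); elim: m f => // m IHm f szm f0.
have [c [g [c0 fE prg]]] := primitive_part f0.
have szfg : size f = size g by rewrite fE mul_polyC size_scale.
have g0 : g != 0 by apply: contraNneq f0 => g0; rewrite fE g0 mulr0.
rewrite fE; apply: prime_productM; first by apply/prime_product_polyC/factR.
have [szg|] := leqP (size g) 1.
  have [k gE] : exists k, g = k%:P by exists g`_0; apply: size1_polyC.
  have k0 : k != 0 by rewrite -polyC_eq0 -gE.
  by rewrite gE; apply/prime_product_polyC/factR.
move=> /irreducible_factor[h irrh hg].
(* The factor [h] need not be primitive. Its primitive part [q] differs from it by a scalar, so it
   is still irreducible and still divides [g] up to a scalar. *)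
have [b [q [b0 hE prq]]] := primitive_part (irredp_neq0 irrh).
have hq : Pdiv.Idomain.eqp q h.
  apply/Pdiv.Idomain.eqpP; exists (b, 1); rewrite ?oner_neq0 ?b0 //=.
  by rewrite scale1r hE mul_polyC.
have irrq : irreducible_poly q.
  split=> [|r szr rq]; first by rewrite (Pdiv.Idomain.eqp_size hq); case: irrh.
  rewrite (Pdiv.Idomain.eqp_rtrans hq); apply: irrh => //.
  by rewrite -(Pdiv.Idomain.eqp_dvdr _ hq).
have qg : Pdiv.Idomain.dvdp q g by rewrite (Pdiv.Idomain.eqp_dvdl _ hq).
have [r gE] := primitive_dvdp prq qg.
have r0 : r != 0 by apply: contraNneq g0 => r0; rewrite gE r0 mulr0.
rewrite gE; apply: PrimeProductMul; first exact: primitive_irreducible_prime.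
apply: IHm => //; rewrite -ltnS (leq_trans _ szm) // ltnS szfg gE.
rewrite size_mul ?(irredp_neq0 irrq) //.
case: irrq => + _; case: (size q) => [|[|k]] // _.
by rewrite addSn /= addSn ltnS leq_addl.
Qed.

End PolyUfd.

(** * Factorization in several variables *)

Lemma ufd_bij (R S : idomainType) (f : {rmorphism R -> S}) :
  bijective f -> ufd S -> ufd R.
Proof.
move=> [g fK gK] factS a a0.
have fI := can_inj fK.
(* Only [f] is given as a morphism; its inverse inherits multiplicativity, and so carries units and
   primes back to [R]. *)
have gM : {morph g : x y / x * y}.
  by move=> x y; apply: fI; rewrite rmorphM /= !gK.
have g1 : g 1 = 1 by apply: fI; rewrite rmorph1 gK.
have g_unit u : (g u \is a GRing.unit) = (u \is a GRing.unit).
  apply/idP/idP=> [/(rmorph_unit f)|/unitrP[v [vu uv]]]; first by rewrite gK.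
  by apply/unitrP; exists (g v); rewrite -!gM vu uv g1.
have dvd_f p x : divides (g p) x <-> divides p (f x).
  split=> -[y yE]; first by exists (f y); rewrite yE rmorphM /= gK.
  by exists (g y); rewrite -gM -yE fK.
rewrite -[a]fK; have fa0 : f a != 0 by rewrite -(inj_eq fI) rmorph0 in a0.
elim: (factS _ fa0) => [u uu|p b [p0 pu pP] _ IHb].
  by apply: PrimeProductUnit; rewrite g_unit.
rewrite gM; apply: PrimeProductMul => //; split.
- by rewrite -(inj_eq fI) rmorph0 gK.
- by rewrite g_unit.
- by move=> x y; rewrite !dvd_f rmorphM => /pP.
Qed.

Section Muni.
Variables (n : nat) (R : comNzRingType).

Lemma muniX (m : 'X_{1..n.+1}) : muni ('X_[m] : {mpoly R[n.+1]}) =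
  'X_[[multinom m (widen_ord (leqnSn n) i) | i < n]] *: 'X^(m ord_max).
Proof. by rewrite muniE msuppX big_seq1 mcoeffX eqxx scale1r. Qed.

Lemma muni_mwiden (p : {mpoly R[n]}) : muni (mwiden p) = p%:P.
Proof.
elim/mpolyind: p => [|c m p _ _ IHp]; first by rewrite mwiden0 muni0.
rewrite mwidenD muniD IHp mwidenZ muniZ mwidenX muniX mnmwiden_ordmax.
rewrite expr0 polyCD -mul_mpolyC polyCM -mul_polyC; congr (_ * _ + _).
rewrite alg_polyC; congr ('X_[_])%:P.
by apply/mnmP=> i; rewrite mnmE mnmwiden_widen.
Qed.

(** [muni] singles out the last variable. The inverse embeds the coefficients and evaluates at
    ['X_ord_max]. This drives the induction on the number of variables. *)
Lemma muni_bij : bijective (@muni n R).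
Proof.
pose g (f : {poly {mpoly R[n]}}) := (map_poly (@mwiden n R) f).['X_ord_max].
exists g => [p|f].
  rewrite [RHS]mpolyE muniE /g rmorph_sum horner_sum; apply: eq_bigr => m _.
  rewrite /= map_polyZ map_polyXn hornerZ hornerXn /= mwidenZ mwidenX -scalerAl.
  rewrite mpolyXn -mpolyXD; congr (_ *: 'X_[_]).
  apply/mnmP=> i; rewrite mnmDE mulmnE mnm1E; have [<-|ni] := eqVneq ord_max i.
    by rewrite mnmwiden_ordmax mul1n.
  have [j ->] : exists j, i = widen_ord (leqnSn n) j.
    have ltin : (i < n)%N by rewrite ltn_neqAle -ltnS ltn_ord andbT eq_sym ni.
    by exists (Ordinal ltin); apply/val_inj.
  by rewrite mnmwiden_widen mnmE mul0n addn0.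
rewrite /g; elim/poly_ind: f => [|f c IHf].
  by rewrite rmorph0 horner0 muni0.
rewrite rmorphD rmorphM /= map_polyX map_polyC hornerMXaddC muniD muniM IHf.
rewrite /= muni_mwiden muniX mnmE eqxx expr1 -[X in _ * X + _]scale1r.
congr (_ * (_ *: _) + _); rewrite -mpolyX0; congr 'X_[_].
apply/mnmP=> i; rewrite !mnmE; case: eqP => // /(congr1 val)/= ni.
by have := ltn_ord i; rewrite -ni ltnn.
Qed.

End Muni.

Lemma ufd_mpoly (F : fieldType) (n : nat) : ufd {mpoly F[n]}.
Proof.
elim: n => [|n IHn].
  (* Without variables the only monomial is 1, so a nonzero polynomial is a nonzero constant. *)
  move=> p p0; apply: PrimeProductUnit.
  have pE : p = (p@_0)%:MP.
    apply/mpolyP => m; rewrite mcoeffC [m](_ : _ = 0%MM) ?eqxx ?mulr1 //.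
    by apply/mnmP => -[].
  have c0 : p@_0 != 0 by apply: contraNneq p0 => p00; rewrite pE p00.
  apply/unitrP; exists (p@_0)^-1%:MP.
  by rewrite {2 3}pE -!mpolyCM mulVf // mulfV.
exact: ufd_bij (muni_bij n F) (ufd_poly IHn).
Qed.

(** A common prime divisor of [A] and [B] would be a nonzero constant, hence a unit. *)
Lemma mpoly_coprime_dvdM (F : fieldType) (n : nat) (A B C : {mpoly F[n]}) :
  A != 0 ->
  (forall D, mdvd D A -> mdvd D B -> exists c : F, D = c%:MP) ->
  mdvd A (B * C) -> mdvd A C.
Proof.
move=> A0 cop; apply: coprime_dvdM; first exact: ufd_mpoly.
move=> p [p0 /negP pu _] pA pB; have [c pE] := cop p pA pB.
apply: pu; apply/unitrP; exists (c^-1)%:MP.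
have c0 : c != 0 by apply: contraNneq p0 => c0; rewrite pE c0.
by rewrite pE -!mpolyCM mulVf // mulfV.
Qed.

(** * Homogeneous components and dimensions of spaces of forms *)

Section Homogeneous.
Variables (R : idomainType) (n : nat).
Implicit Types (G P : {mpoly R[n]}).

(** Multiplication by [G] shifts every degree by [e], so it commutes with taking components up to
    that shift. This serves for cofactors [P] that are not known to be homogeneous. *)
Lemma pihomogM e d G P : G \is e.-homog ->
  pihomog mdeg d (G * P) = if (e <= d)%N then G * pihomog mdeg (d - e) P else 0.
Proof.
move=> homG; elim/mpolyind: P => [|c m P _ _ IHP].
  by rewrite mulr0 !pihomog0 mulr0 if_same.
rewrite mulrDr !pihomogD IHP mulrDr -scalerAr !linearZ /= pihomogX -scalerAr.
have homGX : G * 'X_[m] \is (e + mdeg m).-homog.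
  by apply: dhomogM => //; rewrite dhomogX.
have [ed|ed] := leqP e d; last first.
  by rewrite (pihomog_ne0 _ homGX) ?scaler0 ?addr0 // gtn_eqF // ltn_addr.
rewrite -(eqn_add2l e) subnKC //.
have [<-|ne] := eqVneq (e + mdeg m)%N d; first by rewrite pihomog_dE.
by rewrite (pihomog_ne0 ne homGX) mulr0.
Qed.

End Homogeneous.

Lemma mpoly_of_dhomog_eq0 (R : nzRingType) (n d : nat) (G : dhomog n R d) :
  (mpoly_of_dhomog G == 0) = (G == 0).
Proof. exact: (val_eqE G 0). Qed.

Lemma dim_dhomog (F : fieldType) (n m : nat) :
  \dim {: dhomog n.+1 F m} = 'C(n + m, n).
Proof. by rewrite dimvf /dim /= addnC -bin_sub ?leq_addl ?addnK. Qed.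

Section Forms.
Variables (F : finFieldType) (n d e : nat).
Hypothesis led : (e <= d)%N.
Implicit Types (G : dhomog n.+1 F e).

Lemma mulform_eq0 G (P : dhomog n.+1 F (d - e)) :
  G != 0 -> (mulform G P == 0) = (P == 0).
Proof.
move=> G0; rewrite -mpoly_of_dhomog_eq0 mulformE // [LHS]mulf_eq0.
rewrite (mpoly_of_dhomog_eq0 G) (negPf G0) /=.
exact: mpoly_of_dhomog_eq0.
Qed.

(** Multiplication by a nonzero form is injective, so the image has the dimension of the forms of
    degree [d - e]. *)
Lemma dim_formspan G : G != 0 -> \dim (formspan d G) = 'C(n + d - e, n).
Proof.
move=> G0; pose f := GRing.isLinear.Build _ _ _ _ _ (mulform_is_linear led G).
pose g : {linear _ -> _} := HB.pack (mulform (d := d) G) f.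
have fE : linfun (mulform (d := d) G) =1 mulform G := lfunE g.
rewrite /formspan limg_dim_eq ?dim_dhomog ?addnBA //.
apply/eqP; rewrite -subv0; apply/subvP => P /memv_capP[_]; rewrite memv_ker fE.
by rewrite mulform_eq0 // memv0.
Qed.

End Forms.

(** * Intersection of two spans of coprime forms *)

Section Intersection.
Variables (F : finFieldType) (n d e : nat).
Hypothesis led : (e <= d)%N.
Variables (G1 G2 : dhomog n.+1 F e).
Hypotheses (G1_neq0 : G1 != 0) (G2_neq0 : G2 != 0).
Hypothesis G12_coprime : forall D : {mpoly F[n.+1]},
  mdvd D (mpoly_of_dhomog G1) -> mdvd D (mpoly_of_dhomog G2) ->
  exists c : F, D = c%:MP.

(** The cofactor [R] obtained from divisibility need not be known to be homogeneous. Writing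
    [P = G2 R] as its own component of degree [d - e] lets [pihomogM] settle both cases, [d - e < e]
    and [e <= d - e]. *)
Lemma formspan_cap_multiple (H : dhomog n.+1 F d) :
  H \in (formspan d G1 :&: formspan d G2)%VS ->
  exists R : {mpoly F[n.+1]}, mpoly_of_dhomog H =
    mpoly_of_dhomog G1 * pihomog mdeg (d - e) (mpoly_of_dhomog G2 * R).
Proof.
move=> /memv_capP[/(formspanP led)[P HE] /(formspanP led)[Q HE']].
have [|||R PE] := @mpoly_coprime_dvdM _ _ (mpoly_of_dhomog G2)
    (mpoly_of_dhomog G1) (mpoly_of_dhomog P).
- by rewrite mpoly_of_dhomog_eq0.
- by move=> D D2 D1; apply: G12_coprime.
- by exists (mpoly_of_dhomog Q); rewrite -HE.
by exists R; rewrite -PE pihomog_dE ?dhomog_is_dhomog.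
Qed.

Lemma dim_formspan_cap_lt : (d - e < e)%N ->
  \dim (formspan d G1 :&: formspan d G2) = 0%N.
Proof.
move=> lt_e; apply/eqP; rewrite dimv_eq0 -subv0; apply/subvP => H.
move=> /formspan_cap_multiple[R].
rewrite (pihomogM _ _ (dhomog_is_dhomog G2)) leqNgt lt_e.
by rewrite mulr0 memv0 => /eqP; rewrite mpoly_of_dhomog_eq0.
Qed.

Lemma dim_formspan_cap_ge : (e <= d - e)%N ->
  \dim (formspan d G1 :&: formspan d G2) = 'C(n + d - 2 * e, n).
Proof.
move=> le_e; have le2e : (e + e <= d)%N by rewrite -leq_subRL.
(* The intersection is the span of this product, a form of degree [e + e]. *)
pose G := DHomog (dhomogM (dhomog_is_dhomog G1) (dhomog_is_dhomog G2)).
have G0 : G != 0.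
  by rewrite -mpoly_of_dhomog_eq0 /= mulf_neq0 ?mpoly_of_dhomog_eq0.
rewrite mul2n -addnn -(dim_formspan le2e G0); congr (\dim _).
apply/vspaceP => H; apply/idP/(formspanP le2e) => [|[P HE]].
  move=> /formspan_cap_multiple[R].
  rewrite (pihomogM _ _ (dhomog_is_dhomog G2)) le_e -subnDA mulrA => HE.
  (* Only the component of [R] in degree [d - 2e] survives, and it is the required form. *)
  by exists (DHomog (pihomogP mdeg (d - (e + e)) R)).
apply/memv_capP; rewrite subnDA in P HE.
split; apply/(formspanP led).
  have := dhomogM (dhomog_is_dhomog G2) (dhomog_is_dhomog P).
  by rewrite subnKC // => hom; exists (DHomog hom); rewrite HE /= mulrA.
have := dhomogM (dhomog_is_dhomog G1) (dhomog_is_dhomog P).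
by rewrite subnKC // => hom; exists (DHomog hom); rewrite HE /= mulrAC mulrC.
Qed.

End Intersection.

(** * Distance, growth of binomials, and one-dimensional spaces of forms *)

Lemma distv_dim (K : fieldType) (vT : vectType K) (V1 V2 : {vspace vT}) :
  distv V1 V2 = (\dim V1 + \dim V2 - 2 * \dim (V1 :&: V2))%N.
Proof. by rewrite -dimv_sum_cap mul2n -addnn subnDA addnK. Qed.

(** Pascal's rule adds the term ['C(m2 - 1, k - 1)], positive because [k <= m2]. *)
Lemma ltn_binl m1 m2 k : (0 < k)%N -> (k <= m2)%N -> (m1 < m2)%N ->
  ('C(m1, k) < 'C(m2, k))%N.
Proof.
case: k m2 => // k [|m2] // _; rewrite !ltnS => km m12; rewrite binS.
by apply: leq_ltn_trans (leq_bin2l _ m12) _; rewrite -addn1 leq_add2l bin_gt0.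
Qed.

Lemma proportional_dim1 (F : finFieldType) (n e : nat)
    (G1 G2 : dhomog n.+1 F e) :
  \dim {: dhomog n.+1 F e} = 1%N -> G1 != 0 -> G2 != 0 -> proportional G1 G2.
Proof.
move=> dim1 G10 G20.
have : G1 \in <[G2]>%VS.
  suff -> : <[G2]>%VS = fullv by rewrite memvf.
  by apply/eqP; rewrite eqEdim subvf dim1 dim_vline G20.
move=> /vlineP[c G1E]; apply/existsP; exists c; rewrite G1E eqxx andbT.
by apply: contraNneq G10 => c0; rewrite G1E c0 scale0r.
Qed.

Section NForms.
Variables (F : finFieldType) (n e : nat).
Implicit Types G : nform F n e.

Lemma repr_nform_eq0 G : (repr G == 0) = (G == nform0 F n e).
Proof. by rewrite -nform0E reprK. Qed.

Lemma nform_dim1 G1 G2 : \dim {: dhomog n.+1 F e} = 1%N ->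
  G1 != nform0 F n e -> G2 != nform0 F n e -> G1 = G2.
Proof.
move=> dim1 G10 G20; rewrite -[G1]reprK -[G2]reprK; apply/eqmodP.
by apply: proportional_dim1; rewrite // repr_nform_eq0.
Qed.

End NForms.

Theorem theorem3 (F : finFieldType) (n d e : nat) (led : (e <= d)%N)
    (B : {set nform F n e})
    (B_nonzero : nform0 F n e \notin B)
    (B_coprime : forall G1 G2 : nform F n e,
       G1 \in B -> G2 \in B -> G1 != G2 ->
       forall D : {mpoly F[n.+1]},
         nfdvd D G1 -> nfdvd D G2 -> exists c : F, D = c%:MP) :
  [/\ \dim {: dhomog n.+1 F d} = 'C(n + d, n) /\
      (forall V : {vspace dhomog n.+1 F d},
         V \in nformcode d B -> \dim V = 'C(n + d - e, n)),
      #|nformcode d B| = #|B|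
    & forall V1 V2 : {vspace dhomog n.+1 F d},
        V1 \in nformcode d B -> V2 \in nformcode d B -> V1 != V2 ->
        ((d - e < e)%N ->
           \dim (V1 :&: V2) = 0%N /\
           distv V1 V2 = (2 * 'C(n + d - e, n))%N) /\
        ((e <= d - e)%N ->
           \dim (V1 :&: V2) = 'C(n + d - 2 * e, n) /\
           distv V1 V2 =
             (2 * ('C(n + d - e, n) - 'C(n + d - 2 * e, n)))%N)].
Proof.
have B_neq0 G : G \in B -> G != nform0 F n e.
  by apply: contraTneq => ->.
have dimB G : G \in B -> \dim (nformspan d G) = 'C(n + d - e, n).
  by move=> GB; apply: dim_formspan => //; rewrite repr_nform_eq0 B_neq0.
have dimV V : V \in nformcode d B -> \dim V = 'C(n + d - e, n).
  by case/imsetP=> G GB ->; apply: dimB.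
have cap_lt G1 G2 : G1 \in B -> G2 \in B -> G1 != G2 -> (d - e < e)%N ->
    \dim (nformspan d G1 :&: nformspan d G2) = 0%N.
  move=> G1B G2B G12.
  by apply: dim_formspan_cap_lt; rewrite ?repr_nform_eq0 ?B_neq0 //;
    apply: B_coprime.
have cap_ge G1 G2 : G1 \in B -> G2 \in B -> G1 != G2 -> (e <= d - e)%N ->
    \dim (nformspan d G1 :&: nformspan d G2) = 'C(n + d - 2 * e, n).
  move=> G1B G2B G12.
  by apply: dim_formspan_cap_ge; rewrite ?repr_nform_eq0 ?B_neq0 //;
    apply: B_coprime.
(* This makes the dimension ['C(n + d - e, n)] positive, so that a span cannot meet itself in 0. *)
have nleq : (n <= n + d - e)%N by rewrite -addnBA // leq_addr.
split; first by split=> //; apply: dim_dhomog.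
  apply: card_in_imset => G1 G2 G1B G2B eqV; apply/eqP/negPn/negP => G12.
  have [lt_e|le_e] := ltnP (d - e) e.
    have := cap_lt _ _ G1B G2B G12 lt_e; rewrite eqV capvv dimB // => /eqP.
    by rewrite -leqn0 leqNgt bin_gt0 nleq.
  have := cap_ge _ _ G1B G2B G12 le_e; rewrite eqV capvv dimB // => /esym/eqP.
  (* This test covers [n = 0] and [e = 0] at once. Otherwise both are positive, and
     ['C(n + d - 2 * e, n)] is strictly smaller than ['C(n + d - e, n)], against the equality of
     dimensions. *)
  have [dim1|dim_gt1] := eqVneq 'C(n + e, n) 1%N.
    by case/eqP: G12; apply: nform_dim1; rewrite ?dim_dhomog ?B_neq0.
  have n_gt0 : (0 < n)%N.
    by rewrite lt0n; apply: contraNneq dim_gt1 => ->; rewrite bin0.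
  have e_gt0 : (0 < e)%N.
    by rewrite lt0n; apply: contraNneq dim_gt1 => ->; rewrite addn0 binn.
  by rewrite ltn_eqF ?ltn_binl //; lia.
move=> _ _ /imsetP[G1 G1B ->] /imsetP[G2 G2B ->] neqV.
have G12 : G1 != G2 by apply: contraNneq neqV => ->.
(* As both dimensions agree, the distance is twice the codimension of the intersection in either
   space. *)
rewrite distv_dim !dimB // addnn -mul2n -mulnBr.
by split=> [lt_e|le_e]; [rewrite cap_lt // subn0|rewrite cap_ge].
Qed.
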